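(* Let $p$ be a prime, $q=p^m$ with $m\ge1$, and let $H\subseteq\mathbb{F}_q^\ast$ be the multiplicative subgroup of order $r_0$, where $r_0\mid q-1$ and $r_0\equiv1\pmod p$. Let $Q=p^v$ with $v\mid m$, and assume that $Q-1\mid\frac{q-1}{r_0}$ (equivalently, $\mathbb{F}_Q^\ast\subseteq\{x^{r_0}:x\in\mathbb{F}_q^\ast\}$). Let $W\subseteq\mathbb{F}_Q$ be an $\mathbb{F}_p$-linear subspace of dimension $u$, where $0\le u<v$, choose $\xi\in\mathbb{F}_Q\setminus W$, set $D=\xi+W\subseteq\mathbb{F}_Q^\ast$, and define \[ \mathcal{A}=\{\alpha\in\mathbb{F}_q^\ast:\alpha^{r_0}\in D\}, \] which is a disjoint union of $p^u$ multiplicative cosets of $H$, so that $r:=|\mathcal{A}|=p^ur_0$. Let $2\le s\le p$ and assume that $sr=sp^ur_0$ is even. Let $\eta\in\mathbb{F}_q^\ast$, and let $V=(v_{i,\alpha})\in(\mathbb{F}_q^\ast)^{s\times r}$ be a matrix of nonzero multipliers, with columns indexed by the evaluation points $\alpha\in\mathcal{A}$, satisfying \[ v_{i,\alpha}v_{s-i+1,\alpha}=\eta\,\alpha^{s-r_0s},\qquad 1\le i\le s,\quad\alpha\in\mathcal{A} \] (when $s$ is odd, this condition includes the requirement that $\eta\alpha^{s-r_0s}$ is a square in $\mathbb{F}_q^\ast$ for every $\alpha\in\mathcal{A}$; when $s$ is even, such multipliers always exist). Then the HRS code $C=\operatorname{HRS}_{\frac{sr}{2}}(\mathcal{A},V,s,r)$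 is reverse self-dual.
   Context: $\mathbb{F}_Q$ denotes the subfield of $\mathbb{F}_q$ with $Q$ elements. For an integer $h\ge 0$, $\mathcal{P}_{<h}=\{f\in\mathbb{F}_q[x]:\deg f<h\}$. Hasse derivative: for $f(x)=\sum_\ell f_\ell x^\ell\in\mathbb{F}_q[x]$ and $j\ge0$, $\partial^{(j)}f(x)=\sum_{\ell}\binom{\ell}{j}f_\ell x^{\ell-j}$ (with $\binom{\ell}{j}=0$ if $j>\ell$, binomials reduced modulo the characteristic). Hyperderivative Reed–Solomon (HRS) code: for a set $\mathcal{A}=\{\alpha_1,\ldots,\alpha_r\}$ of $r$ distinct elements of $\mathbb{F}_q$, $V=(v_{i,j})\in(\mathbb{F}_q^\ast)^{s\times r}$ (one may index columns by the points $\alpha\in\mathcal{A}$ themselves) and $0\le k\le rs$, \[ \operatorname{HRS}_k(\mathcal{A},V,s,r)=\left\{\bigl(v_{i,j}\,\partial^{(i-1)}f(\alpha_j)\bigr)_{1\le i\le s,\,1\le j\le r}: f\in\mathcal{P}_{<k}\right\}\subseteq\operatorname{Mat}_{s\times r}(\mathbb{F}_q). \] Reverse bilinear form on $\operatorname{Mat}_{s\times r}(\mathbb{F}_q)$: $[A,B]_{\rm rev}=\sum_{j=1}^r\sum_{i=1}^s a_{i,j}b_{s-i+1,j}$. The reverse dual of a linear code $C$ is $C^{\perp_{\rm rev}}=\{B:[A,B]_{\rm rev}=0\text{ for all }A\in C\}$, and $C$ is reverse self-dual if $C=C^{\perp_{\rm rev}}$. *)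

(* Defs.v *)
From HB Require Import structures.
From mathcomp Require Import all_boot all_order all_fingroup all_algebra all_solvable all_field.

Set Implicit Arguments.
Unset Strict Implicit.
Unset Printing Implicit Defensive.

Import GRing.Theory.
Local Open Scope ring_scope.

(* [p^`N(n)] is the n-th Hasse derivative.  Rows are indexed from 0, so row i  *)
(* carries the derivative of order i; column j belongs to the point alpha j.   *)
Definition hrs_word (F : fieldType) (s r : nat) (alpha : 'I_r -> F)
    (V : 'M[F]_(s, r)) (f : {poly F}) : 'M[F]_(s, r) :=
  \matrix_(i < s, j < r) (V i j * (f^`N(i)).[alpha j]).

(* {poly_k F} is the type of polynomials of size at most k, i.e. degree < k.   *)
Definition hrs_code (F : finFieldType) (k s r : nat) (alpha : 'I_r -> F)
    (V : 'M[F]_(s, r)) : {set 'M[F]_(s, r)} :=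
  [set hrs_word alpha V (val f) | f : {poly_k F}].

(* The row index s - i + 1 becomes rev_ord i when rows are numbered from 0.    *)
Definition rev_form (F : fieldType) (s r : nat) (A B : 'M[F]_(s, r)) : F :=
  \sum_(j < r) \sum_(i < s) A i j * B (rev_ord i) j.

Definition rev_dual (F : finFieldType) (s r : nat) (C : {set 'M[F]_(s, r)}) :
    {set 'M[F]_(s, r)} :=
  [set B | [forall A in C, rev_form A B == 0]].

Definition rev_self_dual (F : finFieldType) (s r : nat)
    (C : {set 'M[F]_(s, r)}) : Prop :=
  C = rev_dual C.

Definition nonzero_mx (F : fieldType) (s r : nat) (V : 'M[F]_(s, r)) : Prop :=
  forall i j, V i j != 0.

(* The exponent s - r0 * s is an integer, usually negative. *)
Definition multiplier_rhs (F : fieldType) (s r0 : nat) (eta a : F) : F :=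
  eta * a ^ (s%:Z - (r0 * s)%N%:Z).

Definition multiplier_cond (F : fieldType) (s r r0 : nat) (eta : F)
    (alpha : 'I_r -> F) (V : 'M[F]_(s, r)) : Prop :=
  forall (i : 'I_s) (j : 'I_r),
    V i j * V (rev_ord i) j = multiplier_rhs s r0 eta (alpha j).

Definition eval_points (F : finFieldType) (r0 : nat) (D : {set F}) : {set F} :=
  [set a : F | (a != 0) && (a ^+ r0 \in D)].

(* F regarded as an algebra over its prime field 'F_p, so that subfields and   *)
(* 'F_p-linear subspaces of F are {subfield _} and {vspace _}; the carrier is  *)
(* F itself.                                                                   *)
Definition over_Fp (p m : nat) (F : finFieldType) (p_pr : prime p)
    (cardF : #|F| = (p ^ m)%N) : splittingFieldType 'F_p :=
  pPrimeCharType (card_finPcharP cardF p_pr).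

Definition translate (p m : nat) (F : finFieldType) (p_pr : prime p)
    (cardF : #|F| = (p ^ m)%N) (xi : F) (W : {vspace over_Fp p_pr cardF}) :
    {set F} :=
  [set xi + w | w : F in W].

(* Main.v *)
Require Import Defs.
From HB Require Import structures.
From mathcomp Require Import all_boot all_order all_fingroup all_algebra all_solvable all_field.
From mathcomp Require Import zify.

Set Implicit Arguments.
Unset Strict Implicit.
Unset Printing Implicit Defensive.

Import GRing.Theory.
Local Open Scope ring_scope.

(* Let G be the product of the X - alpha_j and M_j = (G / (X - alpha_j))^s.
   If M_j is a nonzero constant b_j modulo (X - alpha_j)^s, then Hermite
   interpolation reads
      h = \sum_j b_j^-1 M_j T_j    with T_j the Taylor polynomial of h of
   order < s at alpha_j, and comparing top coefficients gives
      \sum_j b_j^-1 h^`N(s-1).[alpha_j] = h`_(sr-1)    for deg h < sr.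
   By the Leibniz rule the reverse form of the words of f and g is thus a
   nonzero multiple of (f g)`_(sr-1).  It vanishes when deg f, deg g < sr/2;
   conversely every matrix is the word of some g with deg g < sr, and if
   deg g >= sr/2 the monomial of degree sr - 1 - deg g is not orthogonal to g.
   Here G = L(X^r0 - alpha^r0) for every root alpha, with L the product of the
   X - w for w in W.  Invariance of W under 'F_p^* gives L = c X + O(X^p), and
   r0 = 1 mod p gives X^r0 - alpha^r0 = alpha^(r0-1) (X - alpha) modulo
   (X - alpha)^p, whence b = (c alpha^(r0-1))^s. *)

(** * Hasse derivatives as Taylor coefficients *)

Lemma coef_comp_XaddC (F : fieldType) (f : {poly F}) (a : F) (i : nat) :
  (f \Po ('X + a%:P))`_i = f^`N(i).[a].
Proof.
rewrite /comp_poly addrC nderiv_taylor; last exact: commr_polyX.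
transitivity (\poly_(j < size f) f^`N(j).[a])`_i.
  rewrite poly_def size_map_polyC !coef_sum; apply: eq_bigr => j _.
  by rewrite nderivn_map horner_map /= mul_polyC.
rewrite coef_poly; case: ltnP => // le_f_i.
by rewrite nderivn_poly0 ?horner0.
Qed.

(** Substituting ['X + a] is multiplicative, so the Leibniz rule is the Cauchy product of two Taylor
    expansions, free of binomial factors. *)
Lemma horner_nderivnM (F : fieldType) (f g : {poly F}) (a : F) (n : nat) :
  (f * g)^`N(n).[a] = \sum_(i < n.+1) f^`N(i).[a] * g^`N(n - i).[a].
Proof.
rewrite -coef_comp_XaddC comp_polyM coefM.
by apply: eq_bigr => i _; rewrite !coef_comp_XaddC.
Qed.

(** The shift by [a] turns the divisor into ['X^n], and divisibility by that is the vanishing of the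
    first [n] Taylor coefficients, in any characteristic. *)
Lemma dvdp_exp_XsubCP (F : fieldType) (f : {poly F}) (a : F) (n : nat) :
  reflect (forall i, (i < n)%N -> f^`N(i).[a] = 0) (('X - a%:P) ^+ n %| f).
Proof.
apply: (iffP idP) => [/dvdpP[q ->] i lt_i_n | f0].
  rewrite -coef_comp_XaddC comp_polyM rmorphXn /= comp_polyB comp_polyX.
  by rewrite comp_polyC addrK coefMXn lt_i_n.
suff /dvdpP[q Dq]: 'X^n %| f \Po ('X + a%:P).
  rewrite -[f](comp_polyXaddC_K _ a) Dq comp_polyM rmorphXn /= comp_polyX.
  exact: dvdp_mulIr.
rewrite -[X in _ %| X](poly_take_drop n) dvdp_add ?dvdp_mulIr //.
rewrite [take_poly _ _](_ : _ = 0) ?dvdp0 //; apply/polyP=> i.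
by rewrite coef_take_poly coef0 coef_comp_XaddC; case: ifP => // /f0.
Qed.

Lemma dvdp_exp_prod_XsubC (F : fieldType) (s : nat) (rs : seq F) (f : {poly F}) :
    uniq rs -> (forall a, a \in rs -> ('X - a%:P) ^+ s %| f) ->
  (\prod_(a <- rs) ('X - a%:P)) ^+ s %| f.
Proof.
elim: rs => [|a rs IHrs] /=; first by rewrite big_nil expr1n dvd1p.
case/andP=> rs'a uniq_rs dvd_f; rewrite big_cons exprMn Gauss_dvdp.
  by rewrite dvd_f ?mem_head //= IHrs // => b rs_b; rewrite dvd_f // mem_behead.
rewrite coprimep_expl // coprimep_expr // coprimep_sym coprimep_XsubC.
by rewrite root_prod_XsubC.
Qed.

Lemma size_monic_exp (F : fieldType) (f : {poly F}) (n : nat) :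
  f \is monic -> size (f ^+ n) = ((size f).-1 * n).+1.
Proof.
move=> mon_f; rewrite -size_exp prednK // size_poly_gt0 monic_neq0 //.
exact: monic_exp.
Qed.

(** * Hermite interpolation and its top coefficient *)

Section HermiteInterpolation.

Variables (F : fieldType) (s r : nat) (alpha : 'I_r -> F) (b : 'I_r -> F).
Hypotheses (s_gt0 : (0 < s)%N) (alpha_inj : injective alpha).

Let cofac (j : 'I_r) : {poly F} := (\prod_(l | l != j) ('X - (alpha l)%:P)) ^+ s.

Hypotheses (b_neq0 : forall j, b j != 0).
Hypothesis cofac_mod : forall j, ('X - (alpha j)%:P) ^+ s %| cofac j - (b j)%:P.

Lemma hermite_inj (f : {poly F}) :
    (size f <= s * r)%N ->
    (forall (i : 'I_s) (j : 'I_r), f^`N(i).[alpha j] = 0) ->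
  f = 0.
Proof.
move=> le_f f0; have [// | nz_f] := eqVneq f 0.
have: (\prod_(a <- [seq alpha j | j : 'I_r]) ('X - a%:P)) ^+ s %| f.
  apply: dvdp_exp_prod_XsubC; first by rewrite map_inj_uniq ?enum_uniq.
  move=> _ /imageP[j _ ->]; apply/dvdp_exp_XsubCP => i lt_i_s.
  exact: (f0 (Ordinal lt_i_s) j).
move/dvdp_leq => /(_ nz_f); rewrite leqNgt size_monic_exp ?monic_prod_XsubC //.
by rewrite size_prod_XsubC size_image card_ord mulnC ltnS le_f.
Qed.

(** Rows are numbered by [nat] so that the derivatives of a polynomial can serve directly as data;
    only the rows below [s] are read. *)
Definition hermite_interp (B : nat -> 'I_r -> F) : {poly F} :=
  \sum_j (b j)^-1 *: (cofac j * \sum_(i < s) B i j *: ('X - (alpha j)%:P) ^+ i).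

Lemma hermite_interpE (B : nat -> 'I_r -> F) (i : nat) (j : 'I_r) :
  (i < s)%N -> (hermite_interp B)^`N(i).[alpha j] = B i j.
Proof.
move=> lt_i_s; pose T := \sum_(i < s) B i j *: ('X - (alpha j)%:P) ^+ i.
have ->: B i j = T^`N(i).[alpha j].
  rewrite -coef_comp_XaddC raddf_sum coef_sum (bigD1 (Ordinal lt_i_s)) //=.
  rewrite linearZ /= rmorphXn /= comp_polyB comp_polyX comp_polyC addrK.
  rewrite coefZ coefXn eqxx mulr1 big1 ?addr0 // => k ne_k_i.
  rewrite linearZ /= rmorphXn /= comp_polyB comp_polyX comp_polyC addrK.
  rewrite coefZ coefXn [i == k]eq_sym (negPf (_ : k != i :> nat)) ?mulr0 //.
apply/eqP; rewrite -subr_eq0 -hornerN -hornerD -nderivnN -nderivnD; apply/eqP.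
move: i lt_i_s; apply/dvdp_exp_XsubCP.
(* Modulo the [s]-th power of ['X - alpha j], the summand [j] reduces to [T] because its cofactor is
   congruent to [b j]; every other cofactor contains that power. *)
rewrite /hermite_interp (bigD1 j) //= -/T addrAC dvdp_add //.
  have ->: (b j)^-1 *: (cofac j * T) - T = ((b j)^-1 *: T) * (cofac j - (b j)%:P).
    rewrite mulrBr scalerAr -scalerAl [T * cofac j]mulrC scalerAr; congr (_ - _).
    by rewrite -scalerAl mulrC mul_polyC scalerA mulVf ?scale1r.
  by rewrite dvdp_mull.
apply: (big_ind (fun f => ('X - (alpha j)%:P) ^+ s %| f)) => [|f g|l ne_l_j].
- exact: dvdp0.
- exact: dvdp_add.
rewrite dvdpZr ?invr_eq0 // dvdp_mulr // dvdp_exp2r //.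
by rewrite (bigD1 j) 1?eq_sym //= dvdp_mulIl.
Qed.

Lemma monic_cofac (j : 'I_r) : cofac j \is monic.
Proof. by rewrite monic_exp ?monic_prod_XsubC. Qed.

Lemma size_cofac (j : 'I_r) : size (cofac j) = (s * r.-1).+1.
Proof.
rewrite size_monic_exp ?monic_prod_XsubC // size_prod => [|l _]; last first.
  by rewrite polyXsubC_eq0.
under eq_bigr => l _ do rewrite size_XsubC.
rewrite sum_nat_const -[#|_|]/#|predC1 j| cardC1 card_ord muln2 -addnn.
by rewrite subSn ?leq_addr // addnK mulnC.
Qed.

Lemma monic_cofacM (j : 'I_r) (i : nat) :
  cofac j * ('X - (alpha j)%:P) ^+ i \is monic.
Proof. by rewrite monicMr ?monic_cofac // monic_exp ?monicXsubC. Qed.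

Lemma size_cofacM (j : 'I_r) (i : nat) :
  size (cofac j * ('X - (alpha j)%:P) ^+ i) = (s * r.-1 + i).+1.
Proof.
rewrite size_monicM ?monic_cofac //; last first.
  by rewrite monic_neq0 ?monic_exp ?monicXsubC.
by rewrite size_exp_XsubC size_cofac addnS.
Qed.

(** The index [j] excludes [r = 0], where the truncated predecessor would break the identity. *)
Lemma muln_pred_ord (j : 'I_r) : (s * r)%N = (s * r.-1 + s)%N.
Proof. by case: r j => [[]|k _] //; rewrite mulnS addnC. Qed.

Lemma size_hermite_interp (B : nat -> 'I_r -> F) :
  (size (hermite_interp B) <= s * r)%N.
Proof.
apply: (leq_trans (size_sum _ _ _)); apply/bigmax_leqP => j _.
rewrite size_scale ?invr_eq0 // mulr_sumr.
apply: (leq_trans (size_sum _ _ _)); apply/bigmax_leqP => i _.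
rewrite -scalerAr (leq_trans (size_scale_leq _ _)) // size_cofacM.
by rewrite (muln_pred_ord j) ltn_add2l.
Qed.

(** Only the Taylor term of order [s.-1] at each point reaches degree [s * r - 1], and there it
    multiplies a monic polynomial. *)
Lemma coef_hermite_interp (B : nat -> 'I_r -> F) :
  (hermite_interp B)`_(s * r).-1 = \sum_j (b j)^-1 * B s.-1 j.
Proof.
rewrite coef_sum; apply: eq_bigr => j _.
have lt_s1 : (s.-1 < s)%N by rewrite prednK.
have Esr : (s * r).-1 = (s * r.-1 + s.-1)%N.
  by rewrite (muln_pred_ord j) -{2}(prednK s_gt0) addnS.
rewrite coefZ mulr_sumr coef_sum (bigD1 (Ordinal lt_s1)) //=.
rewrite -scalerAr coefZ big1 => [|i ne_i].
  have /monicP := monic_cofacM j s.-1.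
  by rewrite lead_coefE size_cofacM /= Esr => ->; rewrite mulr1 addr0.
rewrite -scalerAr coefZ nth_default ?mulr0 // size_cofacM Esr ltn_add2l.
rewrite ltn_neqAle -ltnS prednK // ltn_ord andbT.
by apply: contraNneq ne_i => i_s1; apply/eqP/val_inj.
Qed.

Lemma sum_top_nderivn (h : {poly F}) :
    (size h <= s * r)%N ->
  \sum_j (b j)^-1 * h^`N(s.-1).[alpha j] = h`_(s * r).-1.
Proof.
move=> le_h; pose g := hermite_interp (fun i j => h^`N(i).[alpha j]).
rewrite -(coef_hermite_interp (fun i j => h^`N(i).[alpha j])) -/g.
suff -> : h = g by [].
apply/eqP; rewrite -subr_eq0; apply/eqP/hermite_inj => [|i j].
  rewrite (leq_trans (size_polyD _ _)) // size_polyN geq_max le_h.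
  exact: size_hermite_interp.
by rewrite nderivnB hornerD hornerN hermite_interpE ?subrr.
Qed.

End HermiteInterpolation.

(** * The reverse form as a top coefficient, and self-duality *)

Lemma rev_form_word (F : fieldType) (s r : nat) (alpha : 'I_r -> F)
    (V : 'M[F]_(s, r)) (w : 'I_r -> F) (f g : {poly F}) :
    (0 < s)%N -> (forall i j, V i j * V (rev_ord i) j = w j) ->
  rev_form (hrs_word alpha V f) (hrs_word alpha V g)
    = \sum_j w j * (f * g)^`N(s.-1).[alpha j].
Proof.
case: s V => // s V _ VV; apply: eq_bigr => j _.
(* Row reversal pairs the orders [i] and [s.-1 - i], exactly the pairs in the Leibniz rule of order
   [s.-1]. *)
rewrite horner_nderivnM mulr_sumr /=; apply: eq_bigr => i _.
by rewrite !mxE /= subSS -(VV i j) mulrACA.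
Qed.

Lemma hrs_self_dual (F : finFieldType) (s r : nat) (alpha : 'I_r -> F)
    (V : 'M[F]_(s, r)) (b : 'I_r -> F) (e : F) :
    (0 < s)%N -> injective alpha -> ~~ odd (s * r) ->
    (forall j, b j != 0) ->
    (forall j, ('X - (alpha j)%:P) ^+ s %|
       (\prod_(l | l != j) ('X - (alpha l)%:P)) ^+ s - (b j)%:P) ->
    nonzero_mx V -> e != 0 ->
    (forall i j, V i j * V (rev_ord i) j = e / b j) ->
  rev_self_dual (hrs_code (s * r)./2 alpha V).
Proof.
move=> s_gt0 alpha_inj sr_even b_neq0 b_mod nzV e_neq0 VV.
have Esr : (s * r)%N = ((s * r)./2 + (s * r)./2)%N.
  by rewrite addnn -[LHS]odd_double_half (negPf sr_even).
have formE (f g : {poly F}) : (size (f * g)%R <= s * r)%N ->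
    rev_form (hrs_word alpha V f) (hrs_word alpha V g) = e * (f * g)`_(s * r).-1.
  move=> le_fg; rewrite (rev_form_word _ _ _ s_gt0 VV).
  rewrite -(sum_top_nderivn s_gt0 alpha_inj b_neq0 b_mod le_fg) mulr_sumr.
  by apply: eq_bigr => j _; rewrite mulrA.
apply/setP=> B; rewrite inE; apply/imsetP/forallP => [[g _ ->] A | B_orth].
  apply/implyP=> /imsetP[f _ ->].
  (* Two degrees below [s * r / 2] add up to at most [s * r - 2], one short of the coefficient that
     is read. *)
  have szM : (size (val f * val g)%R <= (s * r).-1)%N.
    rewrite (leq_trans (size_polyMleq _ _)) // -!subn1 leq_sub2r //.
    by rewrite [leqRHS]Esr leq_add ?size_npoly.
  rewrite formE ?(leq_trans szM) ?leq_pred //.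
  by rewrite nth_default ?mulr0.
(* Dividing by the multipliers gives the derivatives that [g] must have; the default 0 occurs only
   in rows that are never read. *)
pose C (i : nat) j := if insub i is Some i' then B i' j / V i' j else 0.
pose g := hermite_interp s alpha b C.
have le_g : (size g <= s * r)%N by apply: size_hermite_interp.
have DB : B = hrs_word alpha V g.
  apply/matrixP=> i j; rewrite mxE hermite_interpE //.
  by rewrite /C valK mulrCA mulfV ?mulr1.
suff le_g2 : (size g <= (s * r)./2)%N.
  by exists (npolyp (s * r)./2 g); rewrite //= npolypK.
rewrite leqNgt; apply/negP => lt_g.
have g_gt0 : (0 < size g)%N by apply: leq_ltn_trans lt_g.
(* This exponent lifts [g] to degree exactly [s * r - 1], and [lt_g] makes it small enough for
   ['X^d] to give a codeword. The form then returns [e] times the leading coefficient, which is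
   nonzero. *)
pose d := (s * r - size g)%N.
have szX : size ('X^d * g)%R = (s * r)%N.
  by rewrite size_monicM ?monicXn -?size_poly_gt0 // size_polyXn addSn subnK.
have le_d : (size ('X^d : {poly F}) <= (s * r)./2)%N.
  by rewrite size_polyXn /d -subSn // leq_subLR [in leqLHS]Esr -addSn leq_add2r.
have := B_orth (hrs_word alpha V 'X^d); rewrite DB formE ?szX //.
have -> : hrs_word alpha V 'X^d \in hrs_code (s * r)./2 alpha V.
  by apply/imsetP; exists (npolyp (s * r)./2 'X^d); rewrite //= npolypK.
rewrite mulf_eq0 (negPf e_neq0) -szX -lead_coefE lead_coef_eq0.
by rewrite -size_poly_eq0 szX -leqn0 leqNgt (leq_trans g_gt0).
Qed.

(** * Subspace polynomials and local expansions in characteristic p *)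

Lemma natr_inj_pchar (F : fieldType) (p i j : nat) :
    p \in [pchar F] -> (i < p)%N -> (j < p)%N -> i%:R = j%:R :> F ->
  i = j.
Proof.
move=> chF; wlog le_ij : i j / (i <= j)%N => [IH lt_i lt_j eq_ij | _ lt_j eq_ij].
  by case/orP: (leq_total i j) => ?; [apply: IH | apply/esym/IH].
apply/eqP; rewrite eqn_leq le_ij -subn_eq0 -leqn0 leqNgt; apply/negP => gt0.
have: (p %| j - i)%N by rewrite (dvdn_pcharf chF) natrB // eq_ij subrr.
by move/(dvdn_leq gt0); rewrite leqNgt (leq_ltn_trans (leq_subr _ _)).
Qed.

(** Scaling by a nonzero [k] of the prime field permutes [W], so [L(kX) = k L(X)] and each
    coefficient satisfies [L_i (k^i - k) = 0]. This kills the degrees strictly between 1 and [p].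
    The linear coefficient survives since 0 is a simple root. *)
Lemma subspace_polyE (F : finFieldType) (p u : nat) (W : {set F}) :
    p \in [pchar F] -> 0 \in W -> {in W &, forall x y, x + y \in W} ->
    #|W| = (p ^ u)%N ->
  exists c R, c != 0 /\ \prod_(w in W) ('X - w%:P) = c *: 'X + 'X^p * R.
Proof.
move=> chF W0 WD cardW; set L := \prod_(w in W) _.
have p_gt1 : (1 < p)%N by rewrite prime_gt1 // (pcharf_prime chF).
have WM k w : w \in W -> w *+ k \in W.
  by move=> Ww; elim: k => [|k IHk]; rewrite ?mulr0n // mulrS WD.
have Lscale k : (k%:R : F) != 0 -> L \Po (k%:R *: 'X) = k%:R *: L.
  move=> nz_k; have kW : [set k%:R * w | w in W] = W.
    apply/eqP; rewrite eqEcard card_imset ?leqnn ?andbT; last exact: mulfI.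
    by apply/subsetP=> _ /imsetP[w Ww ->]; rewrite mulr_natl WM.
  rewrite {1}/L -kW big_imset; last by move=> ? ? _ _; apply: mulfI.
  rewrite rmorph_prod /=.
  transitivity (\prod_(w in W) (k%:R *: ('X - w%:P) : {poly F})).
    apply: eq_bigr => w _; rewrite comp_polyB comp_polyX comp_polyC.
    by rewrite scalerBr -!mul_polyC polyCM.
  rewrite scaler_prod prodr_const cardW; congr (_ *: _).
  (* Frobenius fixes the prime field, so [k] to the power [p ^ u] is [k]. *)
  elim: (u) => [|n IHn]; first by rewrite expr1.
  by rewrite expnSr exprM IHn -(pFrobenius_autE chF) rmorph_nat.
have coefL k i : (k%:R : F) != 0 -> L`_i * ((k%:R : F) ^+ i - k%:R) = 0.
  move/Lscale/(congr1 (fun f : {poly F} => f`_i)).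
  rewrite coefZ mulrBr [_ * k%:R]mulrC => <-; apply/eqP; rewrite subr_eq0.
  have ->: L \Po (k%:R *: 'X) = \poly_(j < size L) (L`_j * k%:R ^+ j).
    by rewrite comp_polyE poly_def; apply: eq_bigr => j _; rewrite exprZn scalerA.
  rewrite coef_poly; case: ltnP => // le_L.
  by rewrite nth_default ?mul0r.
have L0 : L`_0 = 0.
  by rewrite -horner_coef0 horner_prod (bigD1 0) //= hornerXsubC subrr mul0r.
have L1 : L`_1 != 0.
  rewrite /L (bigD1 0) //= subr0 coefXM /= -horner_coef0 horner_prod.
  by apply/prodf_neq0 => w /andP[_ nz_w]; rewrite hornerXsubC sub0r oppr_eq0.
have Lsmall i : (1 < i < p)%N -> L`_i = 0.
  case/andP=> i_gt1 lt_ip; apply/eqP/contraT => nz_Li.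
  (* Otherwise 'X^i - 'X would vanish at all p elements of the prime field. *)
  pose f : {poly F} := 'X^i - 'X.
  have sz_f : size f = i.+1.
    by rewrite size_polyDl ?size_polyN ?size_polyXn ?size_polyX.
  have nz_f : f != 0 by rewrite -size_poly_eq0 sz_f.
  have /(max_poly_roots nz_f) : all (root f) [seq k%:R | k <- iota 0 p].
    apply/allP => _ /mapP[k _ ->]; rewrite rootE !hornerE.
    have [-> | nz_k] := eqVneq (k%:R : F) 0.
      by rewrite expr0n subr0 -[i]prednK // (ltn_trans _ i_gt1).
    by move/eqP: (coefL k i nz_k); rewrite mulf_eq0 (negPf nz_Li).
  rewrite map_inj_in_uniq ?iota_uniq => [/(_ isT)|k l].
    by rewrite size_map size_iota sz_f ltnS leqNgt lt_ip.
  by rewrite !mem_iota /= add0n; apply: natr_inj_pchar.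
exists L`_1, (drop_poly p L); split=> //.
rewrite -[LHS](poly_take_drop p) [drop_poly _ _ * _]mulrC; congr (_ + _).
apply/polyP=> i; rewrite coef_take_poly coefZ coefX.
case: ltnP => [lt_ip | le_pi]; last by rewrite gtn_eqF ?mulr0 ?(leq_trans p_gt1).
by case: i lt_ip => [|[|i]] lt_ip; rewrite ?mulr1 ?mulr0 // Lsmall.
Qed.

Lemma exprB_pchar (R : comNzRingType) (p : nat) (x y : R) :
  p \in [pchar R] -> (x - y) ^+ p = x ^+ p - y ^+ p.
Proof. by move=> chR; rewrite -!(pFrobenius_autE chR) rmorphB. Qed.

Lemma dvdp_subXX (F : fieldType) (f g : {poly F}) (n : nat) :
  f - g %| f ^+ n - g ^+ n.
Proof. by rewrite subrXX dvdp_mulIl. Qed.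

(** Cancelling a linear factor will leave only precision [p.-1]. For [s < p] this suffices, as
    [f - a] divides [f^s - a^s]; the case [s = p] needs Frobenius. *)
Lemma dvdp_exp_sub_const (F : fieldType) (p s : nat) (f h : {poly F}) (a : F) :
    p \in [pchar F] -> (s <= p)%N -> h ^+ p.-1 %| f - a%:P ->
  h ^+ s %| f ^+ s - (a ^+ s)%:P.
Proof.
move=> chF le_sp dvd_f; have p_gt1 := prime_gt1 (pcharf_prime chF).
rewrite polyC_exp; move: le_sp; rewrite leq_eqVlt => /predU1P[-> | lt_sp].
  (* Frobenius raises the precision from p - 1 to p * (p - 1) >= p. *)
  rewrite -exprB_pchar ?pchar_poly //.
  apply: dvdp_trans (dvdp_exp2r p dvd_f).
  by rewrite -exprM dvdp_exp2l // leq_pmull // -subn1 subn_gt0.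
apply: dvdp_trans (dvdp_subXX _ _ _); apply: dvdp_trans dvd_f.
by rewrite dvdp_exp2l // -ltnS prednK // ltnW.
Qed.

(** With [z = X^r0 - a^r0] the product is [L(z) = c z + z^p R(z)], and ['X - a] divides [z], so only
    [c z] matters. One [c] serves every [a], which later keeps the factor [e] of the form
    independent of the point. *)
Lemma dvdp_eval_poly (F : finFieldType) (p u r0 : nat) (W : {set F}) :
    p \in [pchar F] -> 0 \in W -> {in W &, forall x y, x + y \in W} ->
    #|W| = (p ^ u)%N -> r0 = 1 %[mod p] ->
  exists2 c, c != 0 & forall a : F,
    ('X - a%:P) ^+ p %| \prod_(w in W) ('X^r0 - (a ^+ r0 + w)%:P)
                        - (c * a ^+ r0.-1) *: ('X - a%:P).
Proof.
move=> chF W0 WD cardW r0_mod.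
have [c [R [nz_c DL]]] := subspace_polyE chF W0 WD cardW.
have p_gt1 := prime_gt1 (pcharf_prime chF).
exists c => // a; pose z : {poly F} := 'X^r0 - (a ^+ r0)%:P.
have ->: \prod_(w in W) ('X^r0 - (a ^+ r0 + w)%:P) = c *: z + z ^+ p * (R \Po z).
  transitivity ((\prod_(w in W) ('X - w%:P)) \Po z).
    rewrite rmorph_prod; apply: eq_bigr => w _ /=.
    by rewrite comp_polyB comp_polyX comp_polyC polyCD opprD addrA.
  by rewrite DL comp_polyD comp_polyZ comp_polyM comp_polyX rmorphXn /= comp_polyX.
rewrite addrAC -scalerA -scalerBr dvdp_add //; last first.
  by rewrite dvdp_mulr // dvdp_exp2r // /z polyC_exp dvdp_subXX.
rewrite dvdpZr //.
have r0_gt0 : (0 < r0)%N by case: (r0) r0_mod => //; rewrite mod0n modn_small.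
have /dvdnP[k Dk] : (p %| r0.-1)%N by rewrite -subn1 -eqn_mod_dvd // r0_mod.
have Dr0 : r0 = (p * k).+1 by rewrite mulnC -Dk prednK.
(* Since [r0 = p k + 1], the constant terms cancel, and the remaining bracket is divisible by
   [X^p - a^p = (X - a)^p]. *)
have ->: z - a ^+ r0.-1 *: ('X - a%:P) = 'X * ('X^p ^+ k - (a%:P ^+ p) ^+ k).
  rewrite /z Dr0 /= -!exprM mulrBr scalerBr !exprS -mul_polyC polyC_exp.
  rewrite -[in X in _ - (_ - X)]mul_polyC polyC_exp polyCM polyC_exp.
  by rewrite [a%:P * _]mulrC opprB addrA subrK [_ * 'X]mulrC.
by rewrite dvdp_mull // exprB_pchar ?pchar_poly // dvdp_subXX.
Qed.

Lemma dvdp_cofactor (F : finFieldType) (p s r : nat) (alpha : 'I_r -> F)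
    (j : 'I_r) (c : F) :
    p \in [pchar F] -> (s <= p)%N ->
    ('X - (alpha j)%:P) ^+ p %|
      \prod_l ('X - (alpha l)%:P) - c *: ('X - (alpha j)%:P) ->
  ('X - (alpha j)%:P) ^+ s %|
    (\prod_(l | l != j) ('X - (alpha l)%:P)) ^+ s - (c ^+ s)%:P.
Proof.
move=> chF le_sp; rewrite (bigD1 j) //= -mul_polyC [c%:P * _]mulrC -mulrBr.
rewrite -[p in _ ^+ p]prednK ?prime_gt0 ?(pcharf_prime chF) // exprS.
by rewrite dvdp_mul2l ?polyXsubC_eq0 //; apply: dvdp_exp_sub_const.
Qed.

(** * Powers and cosets in the cyclic unit group *)

Lemma mem_unit_group (F : finFieldType) (H : {group {unit F}}) (x : {unit F}) :
  (x \in H) = (val x ^+ #|H| == 1).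
Proof.
(* In a cyclic group, inclusion of subgroups is divisibility of their orders. *)
rewrite -cycle_subG -(@cardSg_cyclic _ [set: {unit F}]) ?subsetT
  ?field_unit_group_cyclic //.
by rewrite order_dvdn -val_eqE /= FinRing.val_unitX.
Qed.

(** For a generator [g] and [x = g^i], the equation on [x] says that [#|F|.-1] divides
    [i * (#|F|.-1 %/ e)], that is, [e] divides [i]. *)
Lemma finField_powerP (F : finFieldType) (e : nat) (x : F) :
    (e %| #|F|.-1)%N -> x != 0 ->
  (exists2 y : F, y != 0 & x = y ^+ e) <-> x ^+ (#|F|.-1 %/ e) = 1.
Proof.
move=> dvd_e nz_x; split=> [[y nz_y ->] | x1].
  rewrite -exprM mulnC divnK //; apply: (mulfI nz_y).
  rewrite mulr1 -exprS prednK ?expf_card //; exact: ltnW (finNzRing_gt1 F).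
have /cyclicP[g Dg] := field_unit_group_cyclic [set: {unit F}]%G.
have og : #[g]%g = #|F|.-1 by rewrite -card_finField_unit orderE -Dg.
have Ux : x \is a GRing.unit by rewrite unitfE.
have /cycleP[i Di] : FinRing.unit F Ux \in <[g]>%g by rewrite -Dg inE.
have Dx : x = val g ^+ i by rewrite -FinRing.val_unitX -Di.
have F_gt1 : (0 < #|F|.-1)%N by rewrite -subn1 subn_gt0 finNzRing_gt1.
have e_gt0 : (0 < e)%N by apply: dvdn_gt0 dvd_e.
have /dvdnP[k Dk] : (e %| i)%N.
  have : (#[g]%g %| i * (#|F|.-1 %/ e))%N.
    by rewrite order_dvdn -val_eqE /= FinRing.val_unitX exprM -Dx x1.
  rewrite og -{1}(divnK dvd_e) mulnC dvdn_pmul2r // divn_gt0 //.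
  exact: dvdn_leq.
exists (val (g ^+ k)%g); first by rewrite -unitfE (valP (g ^+ k)%g).
by rewrite FinRing.val_unitX -exprM -Dk.
Qed.

(** By finiteness, the nonzero part of [K] is a group; it is cyclic, so the power criterion need
    only be tested on a generator. *)
Lemma sub_powers_dvd (F : finFieldType) (e : nat) (K : {set F}) :
    0 \in K -> 1 \in K -> {in K &, forall x y, x * y \in K} ->
    (e %| #|F|.-1)%N ->
  (#|K|.-1 %| #|F|.-1 %/ e)%N <->
    (forall x, x \in K -> x != 0 -> exists2 y : F, y != 0 & x = y ^+ e).
Proof.
move=> K0 K1 KM dvd_e; pose U := [set x : {unit F} | val x \in K].
have gU : group_set U.
  apply/group_setP; split=> [|x y]; rewrite !inE // => Kx Ky.
  by rewrite FinRing.val_unitM KM.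
have cardU : #|Group gU| = #|K|.-1.
  rewrite (cardsD1 0 K) K0 add1n /= -(card_imset U val_inj).
  apply: eq_card => x; rewrite !inE; apply/imsetP/andP => [[y] | [nz_x Kx]].
    by rewrite inE => Ky ->; rewrite -unitfE (valP y).
  have Ux : x \is a GRing.unit by rewrite unitfE.
  by exists (FinRing.unit F Ux); rewrite ?inE.
split=> [/dvdnP[k Dk] x Kx nz_x | powK].
  apply/finField_powerP => //; have Ux : x \is a GRing.unit by rewrite unitfE.
  have : FinRing.unit F Ux \in Group gU by rewrite inE.
  by rewrite mem_unit_group cardU Dk mulnC exprM => /eqP->; rewrite expr1n.
have /cyclicP[g Dg] := field_unit_group_cyclic (Group gU).
rewrite -cardU Dg -orderE order_dvdn -val_eqE /= FinRing.val_unitX; apply/eqP.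
have nz_g : val g != 0 by rewrite -unitfE (valP g).
apply/finField_powerP => //; apply: powK => //.
have: g \in Group gU by rewrite Dg cycle_id.
by rewrite inE.
Qed.

(** The fibres of the map raising units to the power [#|H|] are the cosets of [H], its kernel; each
    [d] in [D] contributes one. *)
Lemma eval_points_cosets (F : finFieldType) (H : {group {unit F}}) (D : {set F}) :
    (forall d, d \in D -> exists2 y : F, y != 0 & d = y ^+ #|H|) ->
  exists P : {set {set {unit F}}},
    [/\ P \subset rcosets H [set: {unit F}], trivIset P, #|P| = #|D|
      & eval_points #|H| D = [set val x | x in cover P]].
Proof.
move=> rootD.
(* A chosen root of [d]; the default 1 never arises for [d] in [D]. *)
pose f (d : F) : {unit F} :=
  odflt 1%g [pick y : {unit F} | val y ^+ #|H| == d].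
have fP d : d \in D -> val (f d) ^+ #|H| = d.
  case/rootD=> y nz_y Dd; rewrite /f; case: pickP => [z /eqP // | no_z].
  have Uy : y \is a GRing.unit by rewrite unitfE.
  by have := no_z (FinRing.unit F Uy); rewrite /= Dd eqxx.
have mem_coset x y : (x \in H :* y)%g = (val x ^+ #|H| == val y ^+ #|H|).
  rewrite mem_rcoset mem_unit_group FinRing.val_unitM FinRing.val_unitV.
  rewrite exprMn exprVn.
  rewrite -(inj_eq (mulIf (_ : val y ^+ #|H| != 0))) ?mul1r ?divfK //;
    by rewrite expf_neq0 // -unitfE (valP y).
pose P := [set (H :* f d)%g | d in D].
have sP : P \subset rcosets H [set: {unit F}].
  by apply/subsetP=> _ /imsetP[d _ ->]; apply/rcosetsP; exists (f d); rewrite ?inE.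
have tiP : trivIset P.
  by apply: trivIsetS sP _; case/and3P: (rcosets_partition (subsetT H)).
exists P; split=> //.
  rewrite card_in_imset // => d d' Dd Dd' /= eqH.
  by have := rcoset_refl H (f d); rewrite eqH mem_coset !fP // => /eqP.
apply/setP=> a; rewrite inE; apply/andP/imsetP => [[nz_a Da] | [x]].
  have Ua : a \is a GRing.unit by rewrite unitfE.
  exists (FinRing.unit F Ua) => //; apply/bigcupP.
  exists (H :* f (a ^+ #|H|)%R)%g; first exact: imset_f.
  by rewrite mem_coset fP.
case/bigcupP=> _ /imsetP[d Dd ->]; rewrite mem_coset fP // => /eqP xd ->.
by rewrite -unitfE (valP x) xd.
Qed.

(** * The evaluation set and its polynomial *)

Lemma card_eval_points (F : finFieldType) (H : {group {unit F}}) (D : {set F}) :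
    (forall d, d \in D -> exists2 y : F, y != 0 & d = y ^+ #|H|) ->
  #|eval_points #|H| D| = (#|D| * #|H|)%N.
Proof.
case/eval_points_cosets=> P [/subsetP sP /eqP tiP <- ->].
rewrite card_imset; last exact: val_inj.
rewrite -tiP -sum_nat_const; apply: eq_bigr => B /sP /rcosetsP[x _ ->].
exact: card_rcoset.
Qed.

(** The right side is monic of degree [#|D| * r0 = r] and vanishes at the [r] distinct points. *)
Lemma prod_eval_points (F : finFieldType) (r0 r : nat) (D : {set F})
    (alpha : 'I_r -> F) :
    (0 < r0)%N -> injective alpha -> [set alpha j | j : 'I_r] = eval_points r0 D ->
    #|eval_points r0 D| = (#|D| * r0)%N ->
  \prod_l ('X - (alpha l)%:P) = \prod_(d in D) ('X^r0 - d%:P).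
Proof.
move=> r0_gt0 alpha_inj imA cardA.
have Er : r = (#|D| * r0)%N by rewrite -cardA -imA card_imset // card_ord.
have mon (d : F) : 'X^r0 - d%:P \is monic by apply: monicXnsubC.
rewrite [RHS](@all_roots_prod_XsubC _ _ [seq alpha j | j : 'I_r]).
- rewrite (monicP (_ : \prod_(d in D) _ \is monic)); last first.
    by apply: monic_prod => d _.
  by rewrite scale1r big_image.
- rewrite size_prod => [|d _]; last by rewrite monic_neq0.
  under eq_bigr => d _ do rewrite size_XnsubC //.
  rewrite sum_nat_const mulnS addnC subSn ?leq_addl // addnK.
  by rewrite size_image card_ord Er.
- apply/allP => _ /imageP[j _ ->]; rewrite rootE horner_prod.
  have: alpha j \in eval_points r0 D by rewrite -imA imset_f.
  rewrite inE => /andP[_ Daj]; rewrite (bigD1 (alpha j ^+ r0)) //=.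
  by rewrite !hornerE subrr mul0r.
- by rewrite uniq_rootsE map_inj_uniq ?enum_uniq.
Qed.

(** Any element of a coset can be its base point. Recentring [D] at [alpha j ^+ r0] lets the single
    polynomial of [W] serve at every point. *)
Lemma translate_subspace (F : finFieldType) (W : {set F}) (xi d : F) :
    {in W &, forall x y, x + y \in W} -> d \in [set xi + w | w in W] ->
  [set d + w | w in W] = [set xi + w | w in W].
Proof.
move=> WD /imsetP[w0 Ww0 ->]; apply/eqP; rewrite eqEcard.
rewrite !card_imset; try exact: addrI.
rewrite leqnn andbT; apply/subsetP=> _ /imsetP[w Ww ->].
by rewrite -addrA imset_f ?WD.
Qed.

(** * Subspaces and subfields over the prime field *)

Lemma card_over_Fp (p m : nat) (F : finFieldType) (p_pr : prime p)
    (cardF : #|F| = (p ^ m)%N) (W : {vspace over_Fp p_pr cardF}) :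
  #|[set w : F | w \in W]| = (p ^ \dim W)%N.
Proof.
rewrite cardsE.
exact: (etrans (card_vspace W) (congr1 (expn^~ _) (card_Fp p_pr))).
Qed.

Lemma over_Fp_add (p m : nat) (F : finFieldType) (p_pr : prime p)
    (cardF : #|F| = (p ^ m)%N) (W : {vspace over_Fp p_pr cardF}) :
  {in [set w : F | w \in W] &, forall x y, x + y \in [set w : F | w \in W]}.
Proof. by move=> x y; rewrite !inE; apply: memvD. Qed.

Lemma over_Fp_mul (p m : nat) (F : finFieldType) (p_pr : prime p)
    (cardF : #|F| = (p ^ m)%N) (K : {subfield over_Fp p_pr cardF}) :
  {in [set x : F | x \in K] &, forall x y, x * y \in [set x : F | x \in K]}.
Proof. by move=> x y; rewrite !inE; apply: rpredM. Qed.

(** * Multipliers *)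

Lemma multiplier_rhsE (F : fieldType) (s r0 : nat) (c eta a : F) :
    (0 < r0)%N -> c != 0 -> a != 0 ->
  multiplier_rhs s r0 eta a = eta * c ^+ s / (c * a ^+ r0.-1) ^+ s.
Proof.
move=> r0_gt0 nz_c nz_a; rewrite /multiplier_rhs.
(* The exponent is minus that of the residue [b j]; the factor [c ^+ s] is inserted to match it. *)
have -> : (s%:Z - (r0 * s)%N%:Z = - (r0.-1 * s)%N%:Z)%R.
  by rewrite -[in LHS](prednK r0_gt0) mulSn PoszD opprD addrA subrr sub0r.
rewrite exprMn invfM mulrA mulfK ?expf_neq0 // -exprM.
by rewrite -exprnN.
Qed.

Lemma even_multipliers (F : fieldType) (s r : nat) (w : 'I_r -> F) :
    ~~ odd s -> (forall j, w j != 0) ->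
  exists2 V : 'M[F]_(s, r),
    nonzero_mx V & forall i j, V i j * V (rev_ord i) j = w j.
Proof.
move=> s_even nz_w.
(* For even [s] there is no middle row, and reversal exchanges the two halves. *)
exists (\matrix_(i < s, j < r) if (i < s./2)%N then 1 else w j).
  by move=> i j; rewrite mxE; case: ifP => _ //; apply: oner_neq0.
move=> i j; rewrite !mxE /=.
have Es : s = (s./2 + s./2)%N by rewrite addnn -[LHS]odd_double_half (negPf s_even).
have -> : (s - i.+1 < s./2)%N = ~~ (i < s./2)%N.
  by have := ltn_ord i; lia.
by case: ltnP => _ /=; rewrite ?mul1r ?mulr1.
Qed.

(** For odd [s] the middle row [s./2] is fixed by reversal, so its entry is the square root. *)
Lemma odd_multiplier_square (F : fieldType) (s r : nat) (w : 'I_r -> F)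
    (V : 'M[F]_(s, r)) (j : 'I_r) :
    odd s -> nonzero_mx V -> (forall i j, V i j * V (rev_ord i) j = w j) ->
  exists2 c : F, c != 0 & w j = c ^+ 2.
Proof.
move=> s_odd nzV VV; have lt_s : (s./2 < s)%N.
  by rewrite -[ltnRHS]odd_double_half s_odd -addnn ltnS leq_addr.
exists (V (Ordinal lt_s) j); first exact: nzV.
rewrite -(VV (Ordinal lt_s)) expr2; congr (_ * V _ _); apply/val_inj => /=.
by have := odd_double_half s; rewrite s_odd; lia.
Qed.

(** * Self-duality on a union of cosets *)

Theorem theorem20 (p m : nat) (F : finFieldType)
    (p_pr : prime p) (m_gt0 : (0 < m)%N) (cardF : #|F| = (p ^ m)%N)
    (r0 : nat) (H : {group {unit F}}) (cardH : #|H| = r0)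
    (r0_dvd : (r0 %| p ^ m - 1)%N) (r0_mod : r0 = 1 %[mod p])
    (v : nat) (v_dvd : (v %| m)%N)
    (K : {subfield over_Fp p_pr cardF}) (cardK : #|[set x : F | x \in K]| = (p ^ v)%N) :
  ((p ^ v - 1 %| (p ^ m - 1) %/ r0)%N <->
     (forall x : F, x \in K -> x != 0 -> exists2 y : F, y != 0 & x = y ^+ r0))
  /\
  ((p ^ v - 1 %| (p ^ m - 1) %/ r0)%N ->
   forall (u : nat) (W : {vspace over_Fp p_pr cardF}) (xi : F),
     (W <= K)%VS -> \dim W = u -> (u < v)%N -> xi \in K -> xi \notin W ->
   let D : {set F} := translate xi W in
   let A : {set F} := eval_points r0 D in
   [/\ (forall d : F, d \in D -> (d \in K) && (d != 0)),
       (exists P : {set {set {unit F}}},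
          [/\ P \subset rcosets H [set: {unit F}], trivIset P,
              #|P| = (p ^ u)%N & A = [set val x | x in cover P]]),
       #|A| = (p ^ u * r0)%N
     & forall (s r : nat) (alpha : 'I_r -> F) (eta : F),
         (2 <= s <= p)%N -> injective alpha -> [set alpha j | j : 'I_r] = A ->
         ~~ odd (s * r) -> eta != 0 ->
         [/\ (forall V : 'M[F]_(s, r), nonzero_mx V ->
                multiplier_cond r0 eta alpha V ->
                rev_self_dual (hrs_code (s * r)./2 alpha V)),
             (~~ odd s ->
                exists2 V : 'M[F]_(s, r),
                  nonzero_mx V & multiplier_cond r0 eta alpha V)
           & (odd s -> forall V : 'M[F]_(s, r), nonzero_mx V ->
                multiplier_cond r0 eta alpha V ->
                forall j : 'I_r, exists2 c : F,
                  c != 0 & multiplier_rhs s r0 eta (alpha j) = c ^+ 2)]]).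
Proof.
have chF : p \in [pchar F] := card_finPcharP cardF p_pr.
have cardF1 : #|F|.-1 = (p ^ m - 1)%N by rewrite cardF subn1.
have r0_gt0 : (0 < r0)%N by rewrite -cardH cardG_gt0.
have Kpow : (p ^ v - 1 %| (p ^ m - 1) %/ r0)%N <->
     (forall x : F, x \in K -> x != 0 -> exists2 y : F, y != 0 & x = y ^+ r0).
  pose Ks : {set F} := [set x : F | x \in K].
  have Ks0 : 0 \in Ks by rewrite inE; apply: mem0v.
  have Ks1 : 1 \in Ks by rewrite inE; apply: mem1v.
  have r0_dvd1 : (r0 %| #|F|.-1)%N by rewrite cardF1.
  have := sub_powers_dvd Ks0 Ks1 (@over_Fp_mul _ _ _ _ _ K) r0_dvd1.
  rewrite cardK cardF1 -subn1 => -[K1 K2]; split=> [/K1 powK x Kx | powK].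
    by apply: powK; rewrite inE.
  by apply: K2 => x; rewrite inE; apply: powK.
split=> // /Kpow powK u W xi sWK dimW lt_uv Kxi W'xi D A.
pose Ws : {set F} := [set w : F | w \in W].
have cardW : #|Ws| = (p ^ u)%N by rewrite card_over_Fp dimW.
have WsD : {in Ws &, forall x y, x + y \in Ws} := @over_Fp_add _ _ _ _ _ W.
have Ws0 : 0 \in Ws by rewrite inE; apply: mem0v.
have DD : D = [set xi + w | w in Ws].
  by apply/setP=> d; apply/imsetP/imsetP=> -[w Ww ->]; exists w;
    rewrite // inE // in Ww *.
have cardD : #|D| = (p ^ u)%N by rewrite DD card_imset //; apply: addrI.
have DK d : d \in D -> (d \in K) && (d != 0).
  case/imsetP=> w Ww ->; apply/andP; split.
    by apply: memvD => //; apply: (subvP sWK).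
  (* If 0 were in [D], then [xi] would be the opposite of an element of [W]. *)
  apply: contraNneq W'xi => /eqP; rewrite addr_eq0 => /eqP ->.
  exact: etrans (memvN W w) Ww.
have powD d : d \in D -> exists2 y : F, y != 0 & d = y ^+ #|H|.
  by rewrite cardH => /DK/andP[Kd nz_d]; apply: powK.
have [P [sP tiP cardP DA]] := eval_points_cosets powD.
have cardA := card_eval_points powD.
rewrite cardH cardD in cardP DA cardA.
split=> //; first by exists P.
move=> s r alpha eta /andP[s_gt1 le_sp] alpha_inj imA sr_even nz_eta.
have s_gt0 := ltnW s_gt1.
have Aalpha j : (alpha j != 0) && (alpha j ^+ r0 \in D).
  have: alpha j \in A by rewrite -imA imset_f.
  by rewrite inE.
have nz_w j : multiplier_rhs s r0 eta (alpha j) != 0.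
  by rewrite mulf_neq0 // expfz_neq0 //; case/andP: (Aalpha j).
split=> [V nzV VV | s_even | s_odd V nzV VV j].
- have [c nz_c dvd_c] := dvdp_eval_poly chF Ws0 WsD cardW r0_mod.
  pose b j := (c * alpha j ^+ r0.-1) ^+ s.
  (* The scalar [eta * c ^+ s] absorbs the linear coefficient of the subspace polynomial. *)
  apply: (@hrs_self_dual _ _ _ _ _ b (eta * c ^+ s)) => //.
  + move=> j; rewrite expf_neq0 // mulf_neq0 // expf_neq0 //.
    by case/andP: (Aalpha j).
  + move=> j; apply: (@dvdp_cofactor _ p) => //.
    rewrite (prod_eval_points r0_gt0 alpha_inj imA); last by rewrite cardD.
    have /andP[_ Dj] := Aalpha j; rewrite DD in Dj.
    rewrite DD -(translate_subspace WsD Dj) big_imset; last first.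
      by move=> ? ? _ _; apply: addrI.
    exact: dvd_c.
  + by rewrite mulf_neq0 // expf_neq0.
  move=> i j; rewrite VV (multiplier_rhsE _ _ r0_gt0 nz_c) //.
  by case/andP: (Aalpha j).
- exact: even_multipliers.
exact: odd_multiplier_square VV.
Qed.
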